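(* Let $q=p^n$ be a prime power, let $\rho$ be a generator of $\mathbb{F}_q^*$, and let $(a_{11},a_{12}),(a_{21},a_{22}),(a_{31},a_{32})$ be non-collinear exponent vectors, with $\mathcal{C}_{ij}^*$, $B=(b_{rs})$, $d,e,f,k,w,\tilde g$ and $D_\ell$ as defined in the context. Then, for all $i,j$ (indices regarded modulo $q-1$), $$|\mathcal{C}_{ij}^*| = q+1-D_d(i)-D_e(j)-D_f(i-j+w)+N_{ij}$$ for some integers $N_{ij}$ that satisfy: 1. $\sum_{j=0}^{q-2}N_{ij}=0$ for all $i$; 2. $\sum_{i=0}^{q-2}N_{ij}=0$ for all $j$; 3. $\sum_{i-j=r}N_{ij}=0$ for all $r$ (the sum over pairs $(i,j)$ of indices modulo $q-1$ with $i-j\equiv r \pmod{q-1}$); 4. $N_{i+b_{11},\,j+b_{21}}=N_{ij}=N_{i+b_{12},\,j+b_{22}}$ for all $i,j$; 5. $\sum_{i=0}^{q-2}\sum_{j=0}^{q-2}N_{ij}^2 = 2\tilde g\,(q-1)^2 q=(q-1)^2q\,(k-d-e-f+2)$.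
   Context: Let $p$ be a prime, $q=p^n$ with $n\ge 1$, and $\rho$ a generator of the cyclic group $\mathbb{F}_q^*$. Let $a_{rs}$ ($1\le r\le 3$, $1\le s\le 2$) be non-negative integers such that the three vectors $(a_{r1},a_{r2})$ are not collinear, i.e. the integer matrix $$B=\begin{bmatrix} b_{11}&b_{12}\\ b_{21}&b_{22}\end{bmatrix}:=\begin{bmatrix} a_{11}-a_{31}&a_{12}-a_{32}\\ a_{21}-a_{31}&a_{22}-a_{32}\end{bmatrix}$$ satisfies $\det(B)\ne 0$. For integers $i,j$ (only their classes modulo $q-1$ matter, since $\rho^{q-1}=1$) let $$\mathcal{C}_{ij}^*=\{(x,y)\in(\mathbb{F}_q^* )^2 : \rho^i x^{a_{11}}y^{a_{12}}+\rho^j x^{a_{21}}y^{a_{22}}=x^{a_{31}}y^{a_{32}}\}.$$ Constants: $d=\gcd(b_{11},b_{12},q-1)$, $e=\gcd(b_{21},b_{22},q-1)$, $f=\gcd(b_{11}-b_{21},b_{12}-b_{22},q-1)$, $k=\gcd((q-1)\gcd(d,e,f),\det(B))$ (all gcds positive), $w=0$ if $q$ is even and $w=\frac{q-1}{2}$ if $q$ is odd, and $\tilde g=\frac12(k-d-e-f+2)$. For a positive integer $\ell$ and an integer $i$, $D_\ell(i)=\ell$ if $\ell\mid i$ and $D_\ell(i)=0$ otherwise. *)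

(* Defs.v *)
From HB Require Import structures.
From mathcomp Require Import all_boot all_order all_algebra.
From mathcomp Require Import all_fingroup all_solvable.

Set Implicit Arguments.
Unset Strict Implicit.
Unset Printing Implicit Defensive.

Import Order.TTheory GRing.Theory Num.Theory.
Local Open Scope ring_scope.

(* The exponents are a : 'M[nat]_(3, 2), so that the informal a_{rs} is entry
   (r - 1, s - 1).  [lift ord_max] is the inclusion of {0, 1} into {0, 1, 2}. *)
Definition exponent_diff (a : 'M[nat]_(3, 2)) : 'M[int]_2 :=
  \matrix_(r < 2, s < 2) ((a (lift ord_max r) s)%:Z - (a ord_max s)%:Z).

Definition noncollinear (a : 'M[nat]_(3, 2)) : bool :=
  \det (exponent_diff a) != 0.

Definition monomial (F : finFieldType) (a : 'M[nat]_(3, 2)) (r : 'I_3)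
    (x y : F) : F :=
  x ^+ a r 0 * y ^+ a r 1.

Definition torus_curve (F : finFieldType) (rho : {unit F})
    (a : 'M[nat]_(3, 2)) (i j : int) : {set F * F} :=
  [set P : F * F | [&& P.1 != 0, P.2 != 0 &
     FinRing.uval rho ^ i * monomial a 0 P.1 P.2
       + FinRing.uval rho ^ j * monomial a 1 P.1 P.2
       == monomial a ord_max P.1 P.2]].

(* [gcdz] takes nonnegative values, so all the gcds below are positive as soon
   as q > 1 and \det B != 0. *)
Section Constants.
Variables (q : nat) (B : 'M[int]_2).

Definition const_d : int := gcdz (gcdz (B 0 0) (B 0 1)) (q%:Z - 1).
Definition const_e : int := gcdz (gcdz (B 1 0) (B 1 1)) (q%:Z - 1).
Definition const_f : int :=
  gcdz (gcdz (B 0 0 - B 1 0) (B 0 1 - B 1 1)) (q%:Z - 1).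
Definition const_k : int :=
  gcdz ((q%:Z - 1) * gcdz (gcdz const_d const_e) const_f) (\det B).
Definition const_w : int := if odd q then (q.-1./2)%:Z else 0.

(* A rational number, since integrality of the half is not assumed. *)
Definition const_g : rat :=
  (const_k - const_d - const_e - const_f + 2)%:~R / 2.
End Constants.

Definition Dfun (l i : int) : int := if (l %| i)%Z then l else 0.

(* Main.v *)
Require Import Defs.
From HB Require Import structures.
From mathcomp Require Import all_boot all_order all_algebra.
From mathcomp Require Import all_fingroup all_solvable.
From mathcomp Require Import finfield ring.

Set Implicit Arguments.
Unset Strict Implicit.
Unset Printing Implicit Defensive.

Import Order.TTheory GRing.Theory Num.Theory.
Local Open Scope ring_scope.

(** Write [M = q - 1] and identify [F^*] with the integers modulo [M] through
    the powers of [rho].  Dividing the equation by its right-hand side, a point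
    [(rho ^ s, rho ^ t)] lies on the curve exactly when
    [(i + b11 s + b12 t, j + b21 s + b22 t)] lies on the set [L] of pairs
    [(u, v)] with [rho ^ u + rho ^ v = 1].  The count [c i j] is therefore a
    sum of translates of the indicator of [L] along the action of [B] on pairs
    of residues ([card_torus]).

    The set [L] has exactly one point on each row [u = const], column
    [v = const] and diagonal [u - v = const], except that it has none on
    [u = 0], [v = 0] and [u - v = w].  Since the form [b11 s + b12 t] takes the value [x]
    [M d] times if [d] divides [x] and never otherwise ([fiber_lform]), the
    sums of [c] along rows, columns and diagonals are [M ^ 2 - M D_d(i)],
    [M ^ 2 - M D_e(j)] and [M ^ 2 - M D_f(r + w)], and the three families of
    vanishing sums follow.

    For the second moment, the sum of the squares of [c] is [M ^ 2] times the
    sum over [t] of the number of pairs of points of [L] that differ by [B t]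
    ([sum_hits_sqr]).  Two such points solve a 2 x 2 linear system, so that for
    a difference [(x, y)] this number is [q - 2] if [x = y = 0], it is 1 if
    [x], [y] and [x - y] are all nonzero, and 0 otherwise
    ([line_correlation]).  Summing over [t] leaves [M ^ 2 - M (d + e + f)] plus
    [q] times the size of the kernel of [B] modulo [M], and this size is [k] by
    the Smith normal form ([card_kernel]).  The vanishing sums say that [N] is
    orthogonal to the expected value of [c], whose square therefore splits off
    ([sum_deviation_sqr]). *)

(** * Counting along additive maps *)

(** Pairs of elements of finite additive groups form a finite additive group. *)
HB.instance Definition _ (T1 T2 : finZmodType) :=
  GRing.Zmodule.on (T1 * T2)%type.

(** Number of points of the fibre of [phi] over [x], as an integer. *)
Definition fiber (A B : finZmodType) (phi : A -> B) (x : B) : int :=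
  \sum_(t : A) (phi t == x)%:R.

Lemma fiber_image (A B : finZmodType) (phi : {additive A -> B}) (t0 : A) :
  fiber phi (phi t0) = fiber phi 0.
Proof.
rewrite /fiber (reindex_inj (addIr t0)); apply: eq_bigr => t _ /=.
by rewrite raddfD -subr_eq0 addrK.
Qed.

Lemma eq_fiber (A B : finZmodType) (phi psi : A -> B) x :
  phi =1 psi -> fiber phi x = fiber psi x.
Proof. by move=> e; apply: eq_bigr => t _; rewrite e. Qed.

Lemma fiber_out (A B : finZmodType) (phi : A -> B) (x : B) :
  (forall t, phi t <> x) -> fiber phi x = 0.
Proof. by move=> out; apply: big1 => t _; case: eqP => // /out. Qed.

Lemma sum_indic (T : finType) (x : T) (h : T -> int) :
  \sum_y (y == x)%:R * h y = h x.
Proof.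
rewrite (bigD1 x) //= eqxx mul1r big1 ?addr0 // => y /negPf ->.
by rewrite mul0r.
Qed.

Lemma sum_indic_cond (T : finType) (A : pred T) (z0 : T) (h : T -> int) :
  \sum_(z | A z) (z == z0)%:R * h z = (A z0)%:R * h z0.
Proof.
rewrite big_mkcond /= -[RHS](sum_indic z0 (fun z => (A z)%:R * h z)).
by apply: eq_bigr => z _; case: (A z); rewrite ?mul1r ?mul0r ?mulr0.
Qed.

Lemma sum_indic_cond1 (T : finType) (A : pred T) (z0 : T) :
  \sum_(z | A z) (z == z0)%:R = (A z0)%:R :> int.
Proof.
rewrite -[RHS]mulr1 -(sum_indic_cond A z0 (fun=> 1)).
by apply: eq_bigr => z _; rewrite mulr1.
Qed.

Lemma sum_indic1 (T : finType) (x : T) : \sum_y (y == x)%:R = 1 :> int.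
Proof. by rewrite (bigD1 x) //= eqxx big1 ?addr0 // => y /negPf ->. Qed.

Lemma sum_const (T : finType) (c : int) : \sum_(t : T) c = #|T|%:R * c.
Proof. by rewrite sumr_const mulr_natl. Qed.

Lemma sum_fiber (A B : finZmodType) (phi : A -> B) :
  \sum_x fiber phi x = #|A|%:R.
Proof.
rewrite exchange_big /= -[RHS]mulr1 -sum_const; apply: eq_bigr => t _.
by rewrite -[RHS](sum_indic1 (phi t)); apply: eq_bigr => x _; rewrite eq_sym.
Qed.

Lemma dvdzN (l i : int) : (l %| - i)%Z = (l %| i)%Z.
Proof. exact: rpredN. Qed.

(** * Residues modulo [M = m.+1] and linear forms on pairs of residues *)

Section Residues.
Variable m : nat.
Notation G := 'I_m.+1.

(** The class of an integer modulo [m.+1].  The additive group is taken to be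
    ['I_m.+1] and not a ring of integers modulo [m.+1], so that [m = 0] (the
    field with two elements) is covered. *)
Definition res (i : int) : G := (inZp 1 : G) *~ i.

Lemma resD i j : res (i + j) = res i + res j. Proof. exact: mulrzDr. Qed.
Lemma resN i : res (- i) = - res i. Proof. exact: mulrNz. Qed.
Lemma resB i j : res (i - j) = res i - res j.
Proof. by rewrite resD resN. Qed.
Lemma res0 : res 0 = 0. Proof. exact: mulr0z. Qed.
Lemma resM i b : res (i * b) = res i *~ b. Proof. exact: mulrzA. Qed.

Lemma res_nat (n : nat) : res n%:Z = inZp n.
Proof.
rewrite /res -pmulrn Zp_mulrn; apply: val_inj => /=.
by rewrite modnMml mul1n.
Qed.

Lemma res_ord (x : G) : res x%:Z = x. Proof. by rewrite res_nat valZpK. Qed.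

Lemma res_eq0 i : (res i == 0) = (m.+1%:Z %| i)%Z.
Proof.
have nat0 (n : nat) : (res n%:Z == 0) = (m.+1 %| n)%N.
  by rewrite res_nat -val_eqE.
by case: (intP i) => [|n|n];
  rewrite ?res0 ?eqxx ?dvdz0 // ?resN ?oppr_eq0 ?dvdzN nat0.
Qed.

Lemma res_eq i j : (res i == res j) = (i == j %[mod m.+1])%Z.
Proof. by rewrite eqz_mod_dvd -res_eq0 resB subr_eq0. Qed.

Lemma resP x : exists i, x = res i.
Proof. by exists x%:Z; rewrite res_ord. Qed.

Lemma Dfun_add l i x : (l %| x)%Z -> Dfun l (i + x) = Dfun l i.
Proof. by move=> lx; rewrite /Dfun rpredDr. Qed.

(** The function [Dfun l] on classes; it is well defined when [l %| m.+1]. *)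
Definition Dres (l : int) (x : G) : int := Dfun l x%:Z.

Lemma DresE l i : (l %| m.+1%:Z)%Z -> Dres l (res i) = Dfun l i.
Proof.
move=> lM; rewrite /Dres /Dfun; congr (if _ then _ else _).
have: res (res i)%:Z == res i by rewrite res_ord.
rewrite res_eq eqz_mod_dvd => /(dvdz_trans lM) li.
by rewrite -[X in _ = (_ %| X)%Z](subrK (res i)%:Z) rpredDl // -dvdzN opprB.
Qed.

Lemma DresN l x : (l %| m.+1%:Z)%Z -> Dres l (- x) = Dres l x.
Proof. by have [i ->] := resP x => lM; rewrite -resN !DresE // /Dfun dvdzN. Qed.

Lemma Dres0 l : Dres l 0 = l. Proof. by rewrite /Dres /Dfun dvdz0. Qed.

Lemma Dres_sqr l x : Dres l x ^+ 2 = l * Dres l x.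
Proof. by rewrite /Dres /Dfun; case: ifP => _; rewrite ?expr2 ?mulr0. Qed.

Lemma sum_Dres (d : nat) : (d %| m.+1)%N -> \sum_(x : G) Dres d x = m.+1%:Z.
Proof.
move=> dM; have [c Ec] := dvdnP dM.
have d_gt0 : (0 < d)%N by rewrite (dvdn_gt0 _ dM).
(* the number of multiples of d in [1, M] is that in [0, M) *)
have cnt : (\sum_(x < m.+1) (d %| x) = c)%N.
  rewrite -[RHS](mulnK _ d_gt0) -Ec divn_count_dvd big_add1 /= big_mkord.
  by rewrite [LHS]big_ord_recl [RHS]big_ord_recr /= dvdn0 dM addnC.
rewrite [in RHS]Ec PoszM -cnt -[X in X * _]natz natr_sum mulr_suml.
apply: eq_bigr => x _; rewrite /Dres /Dfun dvdzE /=.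
by case: (d %| x)%N; rewrite ?mul1r ?mul0r.
Qed.

(** The linear form [b1 s + b2 t] on pairs [(s, t)] of residues. *)
Definition lform (b1 b2 : int) (t : G * G) : G := t.1 *~ b1 + t.2 *~ b2.

Lemma lformB b1 b2 c1 c2 t :
  lform b1 b2 t - lform c1 c2 t = lform (b1 - c1) (b2 - c2) t.
Proof. by rewrite /lform !mulrzBr opprD addrACA. Qed.

Lemma lform_additive b1 b2 : additive (lform b1 b2).
Proof.
by move=> s t; rewrite /lform /= !mulrzBl opprD addrACA.
Qed.

HB.instance Definition _ b1 b2 :=
  GRing.isZmodMorphism.Build (G * G)%type G (lform b1 b2)
    (lform_additive b1 b2).

Lemma lform_res b1 b2 s t : lform b1 b2 (res s, res t) = res (s * b1 + t * b2).
Proof. by rewrite resD !resM. Qed.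

Notation gcd3 b1 b2 := (gcdz (gcdz b1 b2) m.+1).

Lemma gcd3_dvd_lin b1 b2 s t : (gcd3 b1 b2 %| s * b1 + t * b2)%Z.
Proof.
by rewrite rpredD // dvdz_mull // (dvdz_trans (dvdz_gcdl _ _));
  rewrite ?dvdz_gcdl ?dvdz_gcdr.
Qed.

(** By Bezout, a linear form takes exactly the values divisible by the gcd of
    its coefficients and the modulus. *)
Lemma lform_image b1 b2 i :
  (exists t, lform b1 b2 t = res i) <-> (gcd3 b1 b2 %| i)%Z.
Proof.
split=> [[[s t]]|].
  have [s' ->] := resP s; have [t' ->] := resP t.
  rewrite lform_res => /eqP; rewrite res_eq eqz_mod_dvd.
  move=> /(dvdz_trans (dvdz_gcdr (gcdz b1 b2) _)) dvd.
  by rewrite -[i](subKr (s' * b1 + t' * b2)) rpredB ?gcd3_dvd_lin.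
case/dvdzP=> c ->.
have [u [v uv]] := Bezoutz (gcdz b1 b2) m.+1.
have [u' [v' uv']] := Bezoutz b1 b2.
exists (res (c * u * u'), res (c * u * v')).
apply/eqP; rewrite lform_res res_eq eqz_mod_dvd -uv -uv'.
by apply/dvdzP; exists (- c * v); ring.
Qed.

Lemma card_pair : #|{: G * G}|%:R = m.+1%:Z ^+ 2 :> int.
Proof. by rewrite card_prod card_ord natrM natz expr2. Qed.

(** All nonempty fibres have the size of the kernel, which is found by
    comparing the sums over all [x] of both sides. *)
Lemma fiber_lform b1 b2 x :
  fiber (lform b1 b2) x = m.+1%:Z * Dres (gcd3 b1 b2) x.
Proof.
set d := gcd3 _ _; set M := m.+1%:Z.
have dM : (d %| M)%Z by apply: dvdz_gcdr.
have fibE y : d * fiber (lform b1 b2) y = fiber (lform b1 b2) 0 * Dres d y.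
  have [i ->] := resP y; rewrite DresE // /Dfun; case: ifP => di.
    by have [t <-] := (lform_image b1 b2 i).2 di; rewrite fiber_image mulrC.
  rewrite fiber_out ?mulr0 // => t e.
  have/lform_image : exists t, lform b1 b2 t = res i by exists t.
  by rewrite -/d di.
have Mn0 : M != 0 by [].
have dn0 : d != 0 by rewrite gcdz_eq0 negb_and Mn0 orbT.
have: \sum_y d * fiber (lform b1 b2) y
    = \sum_y fiber (lform b1 b2) 0 * Dres d y.
  exact: eq_bigr.
rewrite -!mulr_sumr sum_fiber card_pair -/M (sum_Dres dM) => e0.
have{e0} e0 : fiber (lform b1 b2) 0 = d * M.
  by apply: (mulIf Mn0); rewrite -e0; ring.
by apply: (mulfI dn0); rewrite fibE e0; ring.
Qed.

End Residues.

(** * The kernel of an integer matrix on pairs of residues *)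

Section Kernel.
Variable m : nat.
Notation G := 'I_m.+1.
Notation M := (m.+1%:Z).
Notation gcd3 b1 b2 := (gcdz (gcdz b1 b2) M).

Lemma ord2P (P : 'I_2 -> Prop) : P 0 -> P 1 -> forall i, P i.
Proof.
move=> P0 P1 [[|[|//]] lt_i2].
  by rewrite (_ : Ordinal _ = 0) //; apply: val_inj.
by rewrite (_ : Ordinal _ = 1) //; apply: val_inj.
Qed.

Lemma sum_ord2 (R : nmodType) (h : 'I_2 -> R) : \sum_i h i = h 0 + h 1.
Proof.
rewrite !big_ord_recl big_ord0 addr0; congr (h _ + h _); exact: val_inj.
Qed.

(** The action of a 2 x 2 integer matrix on pairs of residues, seen as column
    vectors. *)
Definition mxact (A : 'M[int]_2) (t : G * G) : G * G :=
  (lform (A 0 0) (A 0 1) t, lform (A 1 0) (A 1 1) t).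

Lemma mxactM A C t : mxact (A *m C) t = mxact A (mxact C t).
Proof.
case: t => s t; have [s' ->] := resP s; have [t' ->] := resP t.
rewrite /mxact !lform_res !mxE !sum_ord2.
by congr (res _ _, res _ _); ring.
Qed.

Lemma mxact1 t : mxact 1%:M t = t.
Proof.
by case: t => s t; rewrite /mxact /lform !mxE /= !mulr1z !mulr0z addr0 add0r.
Qed.

Lemma mxact0 A : mxact A 0 = 0.
Proof. by rewrite /mxact !raddf0. Qed.

Lemma mxact_inj A : A \in unitmx -> injective (mxact A).
Proof.
move=> uA; apply: (can_inj (g := mxact (invmx A))) => t.
by rewrite -mxactM mulVmx ?mxact1.
Qed.

(** Seen as forms on pairs that ignore the second coordinate, multiplications
    by integers are covered by [fiber_lform]. *)
Lemma card_torsion b : \sum_(s : G) (s *~ b == 0)%:R = gcdz b M :> int.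
Proof.
have := fiber_lform b 0 (0 : G); rewrite Dres0 gcdz0.
have -> : gcdz `|b| M = gcdz b M by rewrite /gcdz absz_nat.
rewrite /fiber.
have -> : \sum_(t : G * G) (lform b 0 t == 0)%:R
        = M * \sum_(s : G) (s *~ b == 0)%:R :> int.
  rewrite -(pair_bigA _ (fun s t => (lform b 0 (s, t) == 0)%:R : int)).
  rewrite mulr_sumr.
  apply: eq_bigr => s _; rewrite /lform /=.
  under eq_bigr do rewrite mulr0z addr0.
  by rewrite sum_const card_ord natz.
by move/mulfI; apply.
Qed.

Lemma eq_gcdz a b a' b' :
  (forall c, (c %| gcdz a b)%Z = (c %| gcdz a' b')%Z) ->
  gcdz a b = gcdz a' b'.
Proof.
move=> eqg; congr Posz; apply/eqP; rewrite eqn_dvd.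
have:= eqg (gcdz a b); have:= eqg (gcdz a' b').
by rewrite !dvdzz !dvdzE !absz_nat => -> <-.
Qed.

Lemma dvdz_entries (A B C : 'M[int]_2) (c : int) :
  (forall i j, (c %| B i j)%Z) -> forall i j, (c %| (A *m B *m C) i j)%Z.
Proof.
move=> cB i j; rewrite mxE; apply: rpred_sum => l _; apply: dvdz_mulr.
by rewrite mxE; apply: rpred_sum => l' _; apply: dvdz_mull.
Qed.

(** Both sides are the gcd of [a1 a2], [a1 c] and [c c], since [a1 c] divides
    [a2 c]. *)
Lemma gcdn_mul_chain a1 a2 c : (a1 %| a2)%N ->
  (gcdn a1 c * gcdn a2 c = gcdn (c * gcdn a1 c) (a1 * a2))%N.
Proof.
move=> /dvdnP[b ->]; rewrite muln_gcdl !muln_gcdr.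
set x := gcdn _ _; set y := gcdn _ _.
have x_dvd z : (z %| x)%N = [&& z %| a1 * (b * a1), z %| a1 * c & z %| c * c]%N.
  rewrite !dvdn_gcd (mulnC a1 c) (mulnCA c b a1) -!andbA; congr andb.
  by case: (boolP (z %| c * a1)%N) => //= zca; rewrite dvdn_mull.
have y_dvd z : (z %| y)%N = [&& z %| a1 * (b * a1), z %| a1 * c & z %| c * c]%N.
  by rewrite !dvdn_gcd (mulnC a1 c) andbC.
by apply/eqP; rewrite eqn_dvd x_dvd -y_dvd dvdnn y_dvd -x_dvd dvdnn.
Qed.

(** By the Smith normal form, [B] acts up to automorphisms as the diagonal
    matrix of its invariant factors [s1 | s2], whose kernel has
    [gcd (s1, M) * gcd (s2, M)] elements. *)
Lemma card_kernel (B : 'M[int]_2) :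
  fiber (mxact B) 0 =
  gcdz (M * gcdz (gcdz (gcd3 (B 0 0) (B 0 1)) (gcd3 (B 1 0) (B 1 1)))
                 (gcd3 (B 0 0 - B 1 0) (B 0 1 - B 1 1)))
       (\det B).
Proof.
have [L uL [R uR [ds ds_sorted defB]]] := int_Smith_normal_form B.
set D : 'M[int]_2 := \matrix_(i, j) _ in defB.
set s1 := ds`_0; set s2 := ds`_1.
have s12 : (s1 %| s2)%Z.
  rewrite /s1 /s2; case: (ds) ds_sorted => [|x [|y r]] //=.
  by case/andP.
have D00 : D 0 0 = s1 by rewrite mxE.
have D11 : D 1 1 = s2 by rewrite mxE.
have D01 : D 0 1 = 0 by rewrite mxE.
have D10 : D 1 0 = 0 by rewrite mxE.
have kerD : fiber (mxact B) 0 = gcdz s1 M * gcdz s2 M.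
  rewrite -!card_torsion big_distrlr /= pair_bigA /=.
  rewrite [RHS](reindex_inj (mxact_inj uR)) /=; apply: eq_bigr => t _.
  rewrite defB !mxactM -{1}(mxact0 L) (inj_eq (mxact_inj uL)).
  rewrite {1}/mxact D00 D01 D10 D11 /lform !mulr0z addr0 add0r.
  by rewrite -mulnb natrM.
rewrite kerD.
have gcdE : gcdz (gcdz (gcd3 (B 0 0) (B 0 1)) (gcd3 (B 1 0) (B 1 1)))
                 (gcd3 (B 0 0 - B 1 0) (B 0 1 - B 1 1)) = gcdz s1 M.
  apply: eq_gcdz => c; rewrite !dvdz_gcd; apply/idP/idP.
    case/andP=> /andP[/andP[/andP[c00 c01] cM] /andP[/andP[c10 c11] _]] _.
    rewrite cM andbT -D00.
    have -> : D = invmx L *m B *m invmx R.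
      by rewrite defB !mulmxA mulVmx // mul1mx mulmxK.
    by apply: dvdz_entries; do 2![elim/ord2P].
  case/andP=> cs1 cM.
  have cB i j : (c %| B i j)%Z.
    rewrite defB; apply: dvdz_entries => {i j} i j.
    elim/ord2P: i; elim/ord2P: j; rewrite ?D00 ?D01 ?D10 ?D11 ?dvdz0 //.
    exact: dvdz_trans cs1 s12.
  by rewrite !cB cM /= !rpredB.
rewrite gcdE.
have unit_abs (A : 'M[int]_2) : A \in unitmx -> `|\det A|%N = 1%N.
  by rewrite unitmxE => /orP[] /eqP ->.
have detB : `|\det B|%N = (`|s1| * `|s2|)%N.
  have detD : \det D = s1 * s2.
    rewrite det_trig ?big_ord_recl ?big_ord0 ?mulr1 -?D00 -?D11.
      by congr (D _ _ * D _ _); apply: val_inj.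
    by apply/is_trig_mxP => i j; elim/ord2P: i; elim/ord2P: j.
  rewrite defB !det_mulmx !abszM (unit_abs _ uL) (unit_abs _ uR) mul1n muln1.
  by rewrite detD abszM.
by rewrite /gcdz detB abszM !absz_nat -PoszM gcdn_mul_chain.
Qed.

End Kernel.

(** * Counts along a pair of homomorphisms *)

Section Averages.
Variables (G T : finZmodType).
Implicit Types P : G -> G -> int.

(** The number of [t] for which [(i + beta1 t, j + beta2 t)] lies in the set
    with indicator [P]. *)
Definition hits P (beta1 beta2 : T -> G) (i j : G) : int :=
  \sum_(t : T) P (i + beta1 t) (j + beta2 t).

Lemma hits_shift P (beta1 beta2 : {additive T -> G}) t0 i j :
  hits P beta1 beta2 (i + beta1 t0) (j + beta2 t0) = hits P beta1 beta2 i j.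
Proof.
rewrite /hits [RHS](reindex_inj (addrI t0)); apply: eq_bigr => t _.
by rewrite !raddfD !addrA.
Qed.

(** If [P] has no point on row [w] and exactly one on every other row, then the
    sum of the hits over [j] counts the [t] with [i + beta1 t] different from
    [w]. *)
Lemma sum_hits P (beta1 beta2 : T -> G) (w : G) (i : G) :
  (forall u, \sum_v P u v = 1 - (u == w)%:R) ->
  \sum_j hits P beta1 beta2 i j = #|T|%:R - fiber beta1 (w - i).
Proof.
move=> rowP; rewrite exchange_big /= -[#|T|%:R]mulr1 -sum_const -sumrB.
apply: eq_bigr => t _; rewrite eq_sym subr_eq eq_sym [_ + i]addrC -rowP.
by rewrite [RHS](reindex_inj (addIr (beta2 t))).
Qed.

(** The same for diagonals, obtained by shearing them into rows. *)
Lemma sum_hits_diag P (beta1 beta2 : T -> G) (w r : G) :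
  (forall u, \sum_v P (u + v) v = 1 - (u == w)%:R) ->
  \sum_j hits P beta1 beta2 (r + j) j
    = #|T|%:R - fiber (fun t => beta1 t - beta2 t) (w - r).
Proof.
move=> rowP; rewrite -(sum_hits (fun t => beta1 t - beta2 t) beta2 r rowP).
apply: eq_bigr => j _; apply: eq_bigr => t _.
by rewrite [r + (_ - _) + _]addrACA subrK.
Qed.

(** The number of pairs of points with difference [(x, y)] in the set with
    indicator [P]. *)
Definition correlation P (x y : G) : int :=
  \sum_u \sum_v P u v * P (u + x) (v + y).

(** Expand the square as a sum over pairs [(s, t)]; moving the base point by
    the image of [s], each term depends on [t - s] only. *)
Lemma sum_hits_sqr P (beta1 beta2 : {additive T -> G}) :
  \sum_i \sum_j hits P beta1 beta2 i j ^+ 2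
    = #|T|%:R * \sum_t correlation P (beta1 t) (beta2 t).
Proof.
pose h s t := \sum_i \sum_j
  P (i + beta1 s) (j + beta2 s) * P (i + beta1 t) (j + beta2 t).
transitivity (\sum_s \sum_t h s t).
  rewrite /h; under [RHS]eq_bigr do rewrite exchange_big /=.
  rewrite [RHS]exchange_big /=; apply: eq_bigr => i _.
  under [RHS]eq_bigr do rewrite exchange_big /=.
  rewrite [RHS]exchange_big /=; apply: eq_bigr => j _.
  by rewrite expr2 /hits big_distrlr.
rewrite -sum_const; apply: eq_bigr => s _.
rewrite (reindex_inj (addrI s)); apply: eq_bigr => t _.
rewrite /correlation [RHS](reindex_inj (addIr (beta1 s))).
apply: eq_bigr => i _.
rewrite [RHS](reindex_inj (addIr (beta2 s))); apply: eq_bigr => j _.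
by rewrite !raddfD !addrA.
Qed.

End Averages.

(** * The deviation from the expected count *)

Section Deviation.
Variables (G : finZmodType) (c : G -> G -> int) (D1 D2 D3 : G -> int) (w : G).
Variables (M d1 d2 d3 : int).
Hypothesis cardG : #|G|%:R = M.
Hypotheses (D1sqr : forall x, D1 x ^+ 2 = d1 * D1 x)
  (D2sqr : forall x, D2 x ^+ 2 = d2 * D2 x)
  (D3sqr : forall x, D3 x ^+ 2 = d3 * D3 x).
Hypotheses (sumD1 : \sum_x D1 x = M) (sumD2 : \sum_x D2 x = M)
  (sumD3 : \sum_x D3 x = M).
Hypotheses (c_row : forall i, \sum_j c i j = M ^+ 2 - M * D1 i)
  (c_col : forall j, \sum_i c i j = M ^+ 2 - M * D2 j)
  (c_diag : forall r, \sum_j c (r + j) j = M ^+ 2 - M * D3 (r + w)).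

(** The expected count; for [M = q - 1] the constant [M + 2] is [q + 1]. *)
Definition expected i j := M + 2 - D1 i - D2 j - D3 (i - j + w).

(** The difference between the count [c] and its expected value. *)
Definition deviation i j := c i j - expected i j.

Let sumD3_row i : \sum_j D3 (i - j + w) = M.
Proof.
rewrite -[RHS]sumD3 [RHS](reindex_inj (h := fun j => i - j + w)) //.
by move=> x y /addIr /addrI /oppr_inj.
Qed.

Let sumD3_col j : \sum_i D3 (i - j + w) = M.
Proof.
rewrite -[RHS]sumD3 [RHS](reindex_inj (h := fun i => i - j + w)) //.
by move=> x y /addIr /addIr.
Qed.

Lemma deviation_row i : \sum_j deviation i j = 0.
Proof.
rewrite sumrB c_row !sumrB !sum_const sumD2 sumD3_row cardG; ring.
Qed.

Lemma deviation_col j : \sum_i deviation i j = 0.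
Proof.
rewrite sumrB c_col !sumrB !sum_const sumD1 sumD3_col cardG; ring.
Qed.

Lemma deviation_diag r : \sum_j deviation (r + j) j = 0.
Proof.
have shiftD1 : \sum_j D1 (r + j) = M.
  by rewrite -[RHS]sumD1 [RHS](reindex_inj (addrI r)).
have constD3 : \sum_j D3 (r + j - j + w) = M * D3 (r + w).
  by under eq_bigr do rewrite addrK; rewrite sum_const cardG.
rewrite sumrB c_diag !sumrB shiftD1 sumD2 constD3 sum_const cardG; ring.
Qed.

(** Summation over all pairs, as a linear functional. *)
Let S (h : G -> G -> int) := \sum_i \sum_j h i j.

Let SD g h : S (fun i j => g i j + h i j) = S g + S h.
Proof. by rewrite /S -big_split; apply: eq_bigr => i _; rewrite big_split. Qed.

Let SZ a h : S (fun i j => a * h i j) = a * S h.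
Proof. by rewrite /S mulr_sumr; apply: eq_bigr => i _; rewrite mulr_sumr. Qed.

Let S_diag (g : G -> G -> int) :
  S (fun i j => g (i - j) j) = \sum_r \sum_j g r j.
Proof.
rewrite /S exchange_big /= [RHS]exchange_big /=; apply: eq_bigr => j _.
by rewrite [RHS](reindex_inj (addIr (- j))).
Qed.

(** The deviation is orthogonal to functions of [i], of [j] and of [i - j],
    hence to the expected value. *)
Let S_dev_exp : S (fun i j => deviation i j * expected i j) = 0.
Proof.
have dev1 a : S (fun i j => a i * deviation i j) = 0.
  by apply: big1 => i _; rewrite -mulr_sumr deviation_row mulr0.
have dev2 a : S (fun i j => a j * deviation i j) = 0.
  rewrite /S exchange_big; apply: big1 => j _.
  by rewrite -mulr_sumr deviation_col mulr0.
have dev3 a : S (fun i j => a (i - j) * deviation i j) = 0.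
  transitivity (S (fun i j => a (i - j) * deviation ((i - j) + j) j)).
    by apply: eq_bigr => i _; apply: eq_bigr => j _; rewrite subrK.
  rewrite (S_diag (fun r j => a r * deviation (r + j) j)).
  by apply: big1 => r _; rewrite -mulr_sumr deviation_diag mulr0.
have -> : S (fun i j => deviation i j * expected i j)
  = S (fun i j => (M + 2 - D1 i) * deviation i j + (- D2 j * deviation i j
         + - D3 (i - j + w) * deviation i j)).
  by apply: eq_bigr => i _; apply: eq_bigr => j _; rewrite /expected; ring.
rewrite !SD (dev1 (fun i => _ - D1 i)) (dev2 (fun j => - D2 j)).
by rewrite (dev3 (fun r => - D3 (r + w))).
Qed.

Let S_exp_sqr :
  S (fun i j => expected i j ^+ 2)
    = M ^+ 2 * (M ^+ 2 - 2 * M - 2 + d1 + d2 + d3).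
Proof.
pose D3' i j := D3 (i - j + w).
have S1 : S (fun i j => D1 i) = M ^+ 2.
  by rewrite /S exchange_big sum_const sumD1 cardG expr2.
have S2 : S (fun i j => D2 j) = M ^+ 2.
  by rewrite /S sum_const sumD2 cardG expr2.
have S3 : S D3' = M ^+ 2.
  rewrite /S; under eq_bigr do rewrite sumD3_row.
  by rewrite sum_const cardG expr2.
have S12 : S (fun i j => D1 i * D2 j) = M ^+ 2.
  by rewrite /S -big_distrlr /= sumD1 sumD2 expr2.
have S13 : S (fun i j => D1 i * D3' i j) = M ^+ 2.
  rewrite /S; under eq_bigr do rewrite -mulr_sumr sumD3_row.
  by rewrite -mulr_suml sumD1 expr2.
have S23 : S (fun i j => D2 j * D3' i j) = M ^+ 2.
  rewrite /S exchange_big /=; under eq_bigr do rewrite -mulr_sumr sumD3_col.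
  by rewrite -mulr_suml sumD2 expr2.
have S0 a : S (fun i j => a) = M ^+ 2 * a.
  by rewrite /S !sum_const cardG mulrA expr2.
have -> : S (fun i j => expected i j ^+ 2) =
  S (fun i j => (M + 2) ^+ 2
     + ((d1 - 2 * (M + 2)) * D1 i + ((d2 - 2 * (M + 2)) * D2 j
     + ((d3 - 2 * (M + 2)) * D3' i j + (2 * (D1 i * D2 j)
     + (2 * (D1 i * D3' i j) + 2 * (D2 j * D3' i j))))))).
  (* D ^ 2 = d D makes the square of each D linear in D *)
  apply: eq_bigr => i _; apply: eq_bigr => j _.
  have := D3sqr (i - j + w); have := D1sqr i; have := D2sqr j.
  rewrite /expected -/(D3' i j).
  set x := D1 i; set y := D2 j; set z := D3' i j => ey ex ez.
  rewrite !mulrBl -ex -ey -ez; ring.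
by rewrite !SD !SZ S0 S1 S2 S3 S12 S13 S23; ring.
Qed.

Lemma sum_deviation_sqr :
  \sum_i \sum_j deviation i j ^+ 2
    = \sum_i \sum_j c i j ^+ 2
      - M ^+ 2 * (M ^+ 2 - 2 * M - 2 + d1 + d2 + d3).
Proof.
rewrite -S_exp_sqr -/(S (fun i j => c i j ^+ 2)).
have -> : S (fun i j => c i j ^+ 2) =
  S (fun i j => deviation i j ^+ 2
       + (2 * (deviation i j * expected i j) + expected i j ^+ 2)).
  apply: eq_bigr => i _; apply: eq_bigr => j _.
  by rewrite /deviation /expected; ring.
by rewrite !SD SZ S_dev_exp mulr0 add0r addrK.
Qed.

End Deviation.

(** * Points of the line [X + Y = 1] in logarithmic coordinates *)

Section Line.
Variables (F : finFieldType) (m : nat) (rho : F).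
Hypothesis cardF : #|F| = m.+2.
Hypothesis rho_prim : m.+1.-primitive_root rho.
Notation G := 'I_m.+1.
Notation M := (m.+1%:Z).

(** The discrete exponential of base [rho]. *)
Definition expo (x : G) : F := rho ^+ x.

Let rho0 : rho != 0.
Proof.
apply/eqP => r0; have/eqP := prim_expr_order rho_prim.
by rewrite r0 expr0n eq_sym oner_eq0.
Qed.

Lemma expo_res i : expo (res m i) = rho ^ i.
Proof.
have rhoM c : rho ^ (c * M) = 1.
  by rewrite mulrC -exprz_exp -exprnP (prim_expr_order rho_prim) exp1rz.
have/eqP: res m (res m i)%:Z = res m i by rewrite res_ord.
rewrite res_eq eqz_mod_dvd => /dvdzP[c /eqP]; rewrite subr_eq => /eqP e.
by rewrite /expo exprnP e expfzDr // rhoM mul1r.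
Qed.

Lemma expoD x y : expo (x + y) = expo x * expo y.
Proof.
have [i ->] := resP x; have [j ->] := resP y.
by rewrite -resD !expo_res expfzDr.
Qed.

Lemma expo0 : expo 0 = 1. Proof. exact: expr0. Qed.

Lemma expo_neq0 x : expo x != 0. Proof. exact: expf_neq0. Qed.

Lemma expo_inj : injective expo.
Proof.
move=> x y /eqP; rewrite (eq_prim_root_expr rho_prim) !modn_small //.
by move/eqP/val_inj.
Qed.

Lemma expo_eq1 x : (expo x == 1) = (x == 0).
Proof. by rewrite -expo0 (inj_eq expo_inj). Qed.

(** The exponential is a bijection onto the nonzero elements of [F]. *)
Lemma sum_expo (h : F -> int) : \sum_x h (expo x) = \sum_(z | z != 0) h z.
Proof.
rewrite -big_imset /=; last by move=> x y _ _; exact: expo_inj.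
apply: eq_bigl => z; have -> : [set expo x | x in predT] = [set~ 0].
  apply/eqP; rewrite eqEcard; apply/andP; split.
    by apply/subsetP => _ /imsetP[x _ ->]; rewrite !inE expo_neq0.
  rewrite card_imset; last exact: expo_inj.
  by rewrite cardsC1 cardF card_ord.
by rewrite !inE.
Qed.

(** The indicator of the line [X + Y = 1] in logarithmic coordinates. *)
Definition line (u v : G) : int := (expo u + expo v == 1)%:R.

Lemma line_row u : \sum_v line u v = 1 - (u == 0)%:R.
Proof.
rewrite (sum_expo (fun z => (expo u + z == 1)%:R)).
have solve z : (expo u + z == 1) = (z == 1 - expo u).
  by rewrite [RHS]eq_sym subr_eq [RHS]eq_sym addrC.
under eq_bigr do rewrite solve.
by rewrite sum_indic_cond1 subr_eq0 eq_sym expo_eq1; case: eqP.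
Qed.

Lemma line_sym u v : line u v = line v u.
Proof. by rewrite /line addrC. Qed.

Lemma line_diag w u : expo w = -1 ->
  \sum_v line (u + v) v = 1 - (u == w)%:R.
Proof.
move=> ew; have -> : (u == w) = (expo u + 1 == 0).
  by rewrite addr_eq0 -ew (inj_eq expo_inj).
under eq_bigr do rewrite /line expoD -[X in _ + X]mul1r -mulrDl.
rewrite (sum_expo (fun z => ((expo u + 1) * z == 1)%:R)).
have [->|s0] := eqVneq (expo u + 1) 0.
  by apply: big1 => z _; rewrite mul0r eq_sym oner_eq0.
have solve z : ((expo u + 1) * z == 1) = (z == (expo u + 1)^-1).
  by rewrite -[RHS](inj_eq (mulfI s0)) mulfV.
under eq_bigr do rewrite solve.
by rewrite sum_indic_cond1 invr_eq0 s0.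
Qed.

(** The points of the line that stay on it when translated by [(x, y)] are the
    solutions of [z + t = 1] and [a z + b t = 1] in nonzero [z] and [t], where
    [a] and [b] are the exponentials of [x] and [y]. *)
Lemma line_correlation x y :
  correlation line x y = 1 - (x == 0)%:R - (y == 0)%:R - (x - y == 0)%:R
    + (M + 1) * ((x == 0) && (y == 0))%:R.
Proof.
pose a := expo x; pose b := expo y.
have -> : correlation line x y =
  \sum_(z : F | z != 0) (1 - z != 0)%:R * (z * a + (1 - z) * b == 1)%:R.
  rewrite -(sum_expo
    (fun z => (1 - z != 0)%:R * (z * a + (1 - z) * b == 1)%:R)).
  apply: eq_bigr => u _.
  rewrite -(sum_indic_cond (fun t => t != 0) (1 - expo u)
    (fun t => (expo u * a + t * b == 1)%:R)).
  rewrite -(sum_expo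
    (fun t => (t == 1 - expo u)%:R * (expo u * a + t * b == 1)%:R)).
  apply: eq_bigr => v _; rewrite /line !expoD -/a -/b; congr (_%:R * _).
  by rewrite [in RHS]eq_sym subr_eq [in RHS]eq_sym [in RHS]addrC.
have eqE z : (z * a + (1 - z) * b == 1) = (z * (a - b) == 1 - b).
  by rewrite -subr_eq0 -[RHS]subr_eq0; congr (_ == 0); ring.
rewrite subr_eq0; have [exy|nxy] := eqVneq x y.
  rewrite -exy andbb.
  have -> : (\sum_(z : F | z != 0)
      (1 - z != 0)%:R * (z * a + (1 - z) * b == 1)%:R)%R
    = ((x == 0)%:R * \sum_(z : F | z != 0) (1 - z != 0)%:R)%R :> int.
    rewrite mulr_sumr; apply: eq_bigr => z _.
    rewrite mulrC eqE {1}/a /b -exy subrr.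
    by rewrite mulr0 eq_sym subr_eq0 eq_sym expo_eq1.
  have -> : (\sum_(z : F | z != 0) (1 - z != 0)%:R)%R = M - 1 :> int.
    rewrite -(sum_expo (fun z => (1 - z != 0)%:R)).
    transitivity (\sum_(x : G) (1 - (x == 0)%:R : int)).
      by apply: eq_bigr => t _; rewrite subr_eq0 eq_sym expo_eq1; case: eqP.
    by rewrite sumrB sum_const card_ord sum_indic1 mulr1 natz.
  by case: eqP => _ /=; ring.
have ab0 : a - b != 0 by rewrite subr_eq0 (inj_eq expo_inj).
pose z0 := (1 - b) / (a - b).
have solve z : (z * (a - b) == 1 - b) = (z == z0).
  by rewrite -[RHS](inj_eq (mulIf ab0)) /z0 divfK.
under eq_bigr => z _ do rewrite eqE solve mulrC.
rewrite sum_indic_cond.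
have -> : (z0 != 0) = (y != 0).
  by rewrite mulf_eq0 invr_eq0 (negPf ab0) orbF subr_eq0 eq_sym expo_eq1.
have -> : (1 - z0 != 0) = (x != 0).
  rewrite subr_eq0 -(inj_eq (mulIf ab0)) /z0 divfK // mul1r (inj_eq (addIr _)).
  by rewrite expo_eq1.
by case: (eqVneq x 0) nxy => [->|_]; case: (eqVneq y 0) => [_|_] //=;
  move=> _; ring.
Qed.

End Line.

(** * The torus curve in logarithmic coordinates *)

Section Torus.
Variables (F : finFieldType) (m : nat) (rho : {unit F}).
Hypothesis cardF : #|F| = m.+2.
Hypothesis rho_gen : generator [set: {unit F}] rho.
Notation r := (FinRing.uval rho).
Notation M := (m.+1%:Z).
Notation G := 'I_m.+1.

Lemma generator_prim : m.+1.-primitive_root r.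
Proof.
have ordr : #[rho]%g = m.+1.
  by rewrite orderE -(eqP rho_gen) card_finField_unit cardF.
apply/andP; split=> //; apply/forallP => i; apply/eqP.
rewrite unity_rootE -FinRing.val_unitX -FinRing.val_unit1 (inj_eq val_inj).
rewrite -order_dvdn ordr; apply/idP/eqP => [|->] //.
by move/dvdn_leq => h; apply/eqP; rewrite eqn_leq h // ltn_ord.
Qed.

(** The exponent [w] is the logarithm of [-1]. *)
Lemma expo_w : expo r (res m (const_w m.+2)) = -1.
Proof.
have rprim := generator_prim.
rewrite /const_w; case: ifP => oq; rewrite expo_res //; last first.
  (* when q is even, -1 = (-1) ^ q = 1 *)
  by rewrite expr0z -{1}[-1](expf_card (-1 : F)) cardF -signr_odd oq expr0.
have m1E : (m.+1 = m.+1./2 * 2)%N.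
  have m1_even : odd m.+1 = false by move: oq => /= /negPn ->.
  by rewrite muln2 -[LHS]odd_double_half m1_even.
rewrite -exprnP; set h := m.+1./2 in m1E *.
have: (r ^+ h) ^+ 2 == 1 by rewrite -exprM -m1E (prim_expr_order rprim).
rewrite sqrf_eq1 => /orP[|/eqP //].
rewrite -(prim_order_dvd rprim) => /dvdn_leq; rewrite m1E.
case: (h) m1E => // n _ /(_ isT).
by rewrite leqNgt muln2 -addnn -{1}[n.+1]addn0 ltn_add2l.
Qed.

(** Dividing the equation by its right-hand side turns the exponents into the
    entries of [B]. *)
Lemma card_torus (a : 'M[nat]_(3, 2)) (i j : int) :
  let B := exponent_diff a in
  #|torus_curve rho a i j|%:Z
    = hits (line r) (lform (B 0 0) (B 0 1)) (lform (B 1 0) (B 1 1))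
        (res m i) (res m j).
Proof.
move=> B; have rprim := generator_prim.
have r0 : r != 0.
  by have := expo_neq0 rprim (res m 1); rewrite expo_res // expr1z.
have Erest (h : F -> F -> int) :
    \sum_(P : F * F | (P.1 != 0) && (P.2 != 0)) h P.1 P.2
      = \sum_(t : G * G) h (expo r t.1) (expo r t.2).
  rewrite -(pair_big (fun x : F => x != 0) (fun y : F => y != 0) h) /=.
  rewrite -(pair_bigA _ (fun s t => h (expo r s) (expo r t))) /=.
  rewrite -(sum_expo cardF rprim (fun x => \sum_(y | y != 0) h x y)).
  by apply: eq_bigr => s _; rewrite (sum_expo cardF rprim).
rewrite -natz -sum1_card natr_sum.
transitivity (\sum_(P : F * F | (P.1 != 0) && (P.2 != 0))
  (r ^ i * monomial a 0 P.1 P.2 + r ^ j * monomial a 1 P.1 P.2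
     == monomial a ord_max P.1 P.2)%:R : int).
  rewrite big_mkcond [RHS]big_mkcond /=; apply: eq_bigr => P _.
  rewrite inE; case: (P.1 != 0) => //=; case: (P.2 != 0) => //=.
  by case: (_ == _).
rewrite (Erest (fun x y => (r ^ i * monomial a 0 x y + r ^ j * monomial a 1 x y
     == monomial a ord_max x y)%:R)).
apply: eq_bigr => -[s t] _ /=; congr (nat_of_bool _)%:R.
have [s' es] := resP s; have [t' et] := resP t.
rewrite es et !lform_res -!resD !expo_res //.
have monE l : monomial a l (r ^ s') (r ^ t')
    = r ^ (s' * (a l 0)%:Z + t' * (a l 1)%:Z).
  by rewrite /monomial expfzDr // !exprnP !exprz_exp.
rewrite !monE /B !mxE.
have l0 : lift ord_max (0 : 'I_2) = 0 :> 'I_3 by apply: val_inj.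
have l1 : lift ord_max (1 : 'I_2) = 1 :> 'I_3 by apply: val_inj.
rewrite l0 l1; set e2 := s' * (a ord_max 0)%:Z + t' * (a ord_max 1)%:Z.
rewrite -(inj_eq (mulIf (expfz_neq0 (- e2) r0))) mulrDl -!expfzDr //.
rewrite subrr expr0z.
by congr (r ^ _ + r ^ _ == 1); rewrite /e2; ring.
Qed.

End Torus.

(** * First and second moments of the point counts *)

Section CountSums.
Variables (F : finFieldType) (m : nat) (rho : F) (B : 'M[int]_2) (w : 'I_m.+1).
Hypothesis cardF : #|F| = m.+2.
Hypothesis rho_prim : m.+1.-primitive_root rho.
Hypothesis expo_wN1 : expo rho w = -1.
Notation G := 'I_m.+1.
Notation M := (m.+1%:Z).
Notation gcd3 b1 b2 := (gcdz (gcdz b1 b2) M).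
Notation d := (gcd3 (B 0 0) (B 0 1)).
Notation e := (gcd3 (B 1 0) (B 1 1)).
Notation f := (gcd3 (B 0 0 - B 1 0) (B 0 1 - B 1 1)).
Notation beta1 := (@lform m (B 0 0) (B 0 1)).
Notation beta2 := (@lform m (B 1 0) (B 1 1)).

(** The number of points of the torus curve with coefficients [rho ^ i] and
    [rho ^ j]. *)
Definition curve_count (i j : G) : int := hits (line rho) beta1 beta2 i j.

Lemma fiber_diff x :
  fiber (fun t => beta1 t - beta2 t) x = M * Dres f x.
Proof. by rewrite (eq_fiber _ (@lformB _ _ _ _ _)) fiber_lform. Qed.

Lemma oppr_w : - w = w.
Proof.
apply/eqP; rewrite eq_sym -addr_eq0 -(expo_eq1 rho_prim) (expoD rho_prim).
by rewrite expo_wN1 mulrNN mulr1.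
Qed.

Lemma curve_count_row i : \sum_j curve_count i j = M ^+ 2 - M * Dres d i.
Proof.
rewrite (sum_hits _ _ _ (line_row cardF rho_prim)) card_pair fiber_lform sub0r.
by rewrite DresN // dvdz_gcdr.
Qed.

Lemma curve_count_col j : \sum_i curve_count i j = M ^+ 2 - M * Dres e j.
Proof.
transitivity (\sum_i hits (line rho) beta2 beta1 j i).
  by apply: eq_bigr => i _; apply: eq_bigr => t _; rewrite line_sym.
rewrite (sum_hits _ _ _ (line_row cardF rho_prim)) card_pair fiber_lform sub0r.
by rewrite DresN // dvdz_gcdr.
Qed.

Lemma curve_count_diag r :
  \sum_j curve_count (r + j) j = M ^+ 2 - M * Dres f (r + w).
Proof.
have lineP u : \sum_v line rho (u + v) v = 1 - (u == w)%:R by exact: line_diag.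
rewrite (sum_hits_diag _ _ _ lineP) card_pair fiber_diff.
have -> : w - r = - (r + w) by rewrite opprD oppr_w addrC.
by rewrite DresN ?dvdz_gcdr.
Qed.

Lemma sum_curve_count_sqr :
  \sum_i \sum_j curve_count i j ^+ 2
    = M ^+ 2 * (M ^+ 2 - M * d - M * e - M * f
                + (M + 1) * fiber (@mxact m B) 0).
Proof.
rewrite sum_hits_sqr card_pair; congr (_ * _).
under eq_bigr do rewrite line_correlation // lformB.
rewrite big_split !sumrB /= sum_const card_pair mulr1 -mulr_sumr.
rewrite -[\sum_t (beta1 t == 0)%:R]/(fiber beta1 0).
rewrite -[\sum_t (beta2 t == 0)%:R]/(fiber beta2 0).
rewrite -[\sum_t (lform (_ - _) _ t == 0)%:R]/(fiber (lform _ _) 0).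
by rewrite !fiber_lform !Dres0.
Qed.

End CountSums.

Theorem theorem2p2 (p n q : nat) (F : finFieldType) (rho : {unit F})
    (a : 'M[nat]_(3, 2)) (p_prime : prime p) (n_ge1 : (1 <= n)%N)
    (q_def : q = (p ^ n)%N) (cardF : #|F| = q)
    (rho_gen : generator [set: {unit F}] rho) (a_nc : noncollinear a) :
  let B := exponent_diff a in
  let d := const_d q B in
  let e := const_e q B in
  let f := const_f q B in
  let k := const_k q B in
  let w := const_w q in
  let g := const_g q B in
  exists N : int -> int -> int,
    (* the indices of N are classes modulo q - 1 *)
    (forall i i' j j' : int, (i = i' %[mod q%:Z - 1])%Z ->
       (j = j' %[mod q%:Z - 1])%Z -> N i j = N i' j') /\
    (forall i j : int,
       #|torus_curve rho a i j|%:Z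
         = q%:Z + 1 - Dfun d i - Dfun e j - Dfun f (i - j + w) + N i j) /\
    (forall i : int, \sum_(j < q.-1) N i j%:Z = 0) /\
    (forall j : int, \sum_(i < q.-1) N i%:Z j = 0) /\
    (forall r : int,
       \sum_(i < q.-1)
         \sum_(j < q.-1 | (i%:Z - j%:Z == r %[mod q%:Z - 1])%Z)
           N i%:Z j%:Z = 0) /\
    (forall i j : int,
       N (i + B 0 0) (j + B 1 0) = N i j /\
       N i j = N (i + B 0 1) (j + B 1 1)) /\
    (\sum_(i < q.-1) \sum_(j < q.-1) (N i%:Z j%:Z ^+ 2)%:~R
       = 2 * g * (q%:R - 1) ^+ 2 * q%:R :> rat) /\
    (\sum_(i < q.-1) \sum_(j < q.-1) N i%:Z j%:Z ^+ 2
       = (q%:Z - 1) ^+ 2 * q%:Z * (k - d - e - f + 2)).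
Proof.
have [m qE] : exists m, q = m.+2.
  move: (finNzRing_gt1 F); rewrite cardF.
  by case: (q) => [|[|m]] // _; exists m.
move=> B d e f k w g; move: @d @e @f @k @w @g; rewrite {}qE in cardF q_def *.
have q_succ : m.+2%:Z = m.+1%:Z + 1 by rewrite -PoszD addn1.
have qM : m.+2%:Z - 1 = m.+1%:Z by rewrite q_succ addrK.
rewrite /const_g /const_k /const_d /const_e /const_f qM.
set d := gcdz _ _; set e := gcdz (gcdz (B 1 0) _) _.
set f := gcdz (gcdz (_ - _) _) _.
set k := gcdz _ _; set w := const_w _.
have rho_prim := generator_prim cardF rho_gen.
have wN1 : expo (FinRing.uval rho) (res m w) = -1 by exact: expo_w.
pose c := curve_count (FinRing.uval rho) (m := m) B.
pose dev := deviation c (Dres d) (Dres e) (Dres f) (res m w) m.+1.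
have dM : (d %| m.+1%:Z)%Z by apply: dvdz_gcdr.
have eM : (e %| m.+1%:Z)%Z by apply: dvdz_gcdr.
have fM : (f %| m.+1%:Z)%Z by apply: dvdz_gcdr.
have cardG : #|{: 'I_m.+1}|%:R = m.+1%:Z by rewrite card_ord natz.
have c_row := curve_count_row B cardF rho_prim.
have c_col := curve_count_col B cardF rho_prim.
have c_diag := curve_count_diag B cardF rho_prim wN1.
have sum_sqr : \sum_i \sum_j dev i j ^+ 2
    = m.+1%:Z ^+ 2 * m.+2%:Z * (k - d - e - f + 2).
  rewrite (sum_deviation_sqr cardG (Dres_sqr d) (Dres_sqr e) (Dres_sqr f));
    rewrite ?sum_Dres //.
  rewrite sum_curve_count_sqr // card_kernel -/d -/e -/f -/k.
  by rewrite q_succ; ring.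
exists (fun i j => dev (res m i) (res m j));
  split; [|split; [|split; [|split; [|split; [|split; [|split]]]]]].
- move=> i i' j j' /eqP; rewrite -res_eq => /eqP -> /eqP.
  by rewrite -res_eq => /eqP ->.
- move=> i j; rewrite (card_torus cardF rho_gen) -/B /dev.
  rewrite /deviation /expected -resB -resD.
  by rewrite !DresE // q_succ /c /curve_count; ring.
- move=> i; under eq_bigr do rewrite res_ord.
  by apply: deviation_row; rewrite ?sum_Dres.
- move=> j; under eq_bigr do rewrite res_ord.
  by apply: deviation_col; rewrite ?sum_Dres.
- move=> r.
  transitivity (\sum_j dev (res m r + j) j); last first.
    by apply: deviation_diag; rewrite ?sum_Dres.
  under eq_bigr do rewrite big_mkcond.
  rewrite exchange_big; apply: eq_bigr => j _.
  rewrite -(sum_indic (res m r + j) (fun i => dev i j)); apply: eq_bigr => i _.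
  rewrite -res_eq resB !res_ord subr_eq.
  by case: (_ == _); rewrite ?mul1r ?mul0r.
- move=> i j.
  have shift s t :
      dev (res m (i + (s * B 0 0 + t * B 0 1)))
          (res m (j + (s * B 1 0 + t * B 1 1)))
        = dev (res m i) (res m j).
    rewrite /dev /deviation; congr (_ - _).
      by rewrite 2!resD -!lform_res /c /curve_count hits_shift.
    rewrite /expected -!resB -!resD !DresE //.
    rewrite (Dfun_add i) ?gcd3_dvd_lin // (Dfun_add j) ?gcd3_dvd_lin //.
    have -> : i + (s * B 0 0 + t * B 0 1) - (j + (s * B 1 0 + t * B 1 1)) + w
      = i - j + w + (s * (B 0 0 - B 1 0) + t * (B 0 1 - B 1 1)) by ring.
    by rewrite Dfun_add ?gcd3_dvd_lin.
  (* the columns of B are the images of (1, 0) and (0, 1) *)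
  by have := shift 1 0; have := shift 0 1; rewrite !mul1r !mul0r !addr0 !add0r.
- transitivity ((\sum_i \sum_j dev i j ^+ 2)%:~R : rat).
    rewrite rmorph_sum; apply: eq_bigr => i _.
    by rewrite rmorph_sum; apply: eq_bigr => j _; rewrite !res_ord.
  have -> : m.+2%:R - 1 = m.+1%:R :> rat by rewrite -natr1 addrK.
  rewrite sum_sqr expr2 !intrM -!pmulrn.
  set x := (k - d - e - f + 2)%:~R; by field.
- rewrite -sum_sqr; apply: eq_bigr => i _; apply: eq_bigr => j _.
  by rewrite !res_ord.
Qed.
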